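(* There are absolute constants $c>0$ and $a\ge0$ such that for all positive integers $N\ge2,S,G$ there is a formula of depth at most 3 on $N$ input variables, with formula size at most $S$ and at most $G$ gates, computing a function $f$ with $Q(f)\ge c\min\{N,\sqrt{S},N^{1/2}G^{1/4}\}/\log^a N$.
   Context: A formula on input variables is a rooted tree whose leaves are labeled by input variables (the same variable may label many leaves) and whose internal vertices are \textsc{not} gates (fanin 1) or unbounded-fanin \textsc{and}/\textsc{or} gates. The formula size is the number of leaves; the gate count is the number of \textsc{and} and \textsc{or} gates; the depth is the length of a longest root-to-leaf path (counting \textsc{and}/\textsc{or} levels; \textsc{not} gates may be assumed to be applied only to inputs). $Q(f)$ denotes bounded-error quantum query complexity (error at most $1/3$ on every input, queries via $|i,b\rangle\mapsto|i,b\oplus x_i\rangle$). *)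

(* Defs.v *)
From Stdlib Require Import Reals List Arith.
Import ListNotations.
Open Scope R_scope.

(* NOT gates applied only to inputs: a leaf is a literal (variable, polarity). *)
Inductive formula : Type :=
| Lit  : nat -> bool -> formula
| FAnd : list formula -> formula
| FOr  : list formula -> formula.

Fixpoint feval (x : nat -> bool) (F : formula) : bool :=
  match F with
  | Lit i p => if p then x i else negb (x i)
  | FAnd l => (fix go l := match l with [] => true | g :: r => andb (feval x g) (go r) end) l
  | FOr l => (fix go l := match l with [] => false | g :: r => orb (feval x g) (go r) end) l
  end.

Fixpoint fsize (F : formula) : nat :=
  match F with
  | Lit _ _ => 1
  | FAnd l | FOr l => (fix go l := match l with [] => 0 | g :: r => fsize g + go r end) l
  end%nat.

Fixpoint fgates (F : formula) : nat :=
  match F with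
  | Lit _ _ => 0
  | FAnd l | FOr l => S ((fix go l := match l with [] => 0 | g :: r => fgates g + go r end) l)
  end%nat.

Fixpoint fdepth (F : formula) : nat :=
  match F with
  | Lit _ _ => 0
  | FAnd l | FOr l => S ((fix go l := match l with [] => 0 | g :: r => Nat.max (fdepth g) (go r) end) l)
  end%nat.

Fixpoint fwf (N : nat) (F : formula) : Prop :=
  match F with
  | Lit i _ => (i < N)%nat
  | FAnd l | FOr l => l <> [] /\
      (fix go l := match l with [] => True | g :: r => fwf N g /\ go r end) l
  end.

Record C : Type := mkC { re : R; im : R }.
Definition C0 : C := mkC 0 0.
Definition C1 : C := mkC 1 0.
Definition Cadd (u v : C) : C := mkC (re u + re v) (im u + im v).
Definition Cmul (u v : C) : C :=
  mkC (re u * re v - im u * im v) (re u * im v + im u * re v).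
Definition Cconj (u : C) : C := mkC (re u) (- im u).
Definition Cnorm2 (u : C) : R := re u * re u + im u * im u.

Fixpoint csum (n : nat) (f : nat -> C) : C :=
  match n with O => C0 | S n' => Cadd (csum n' f) (f n') end.
Fixpoint rsum (n : nat) (f : nat -> R) : R :=
  match n with O => 0 | S n' => rsum n' f + f n' end.

(* Basis states |i,b,w> with i < N, b < 2, w < m are encoded as
   k = i + N*b + 2N*w, k < d := N*2*m. *)
Definition dim (N m : nat) : nat := (N * 2 * m)%nat.

Definition unitary (d : nat) (U : nat -> nat -> C) : Prop :=
  forall j k, (j < d)%nat -> (k < d)%nat ->
    csum d (fun i => Cmul (Cconj (U i j)) (U i k)) = (if Nat.eqb j k then C1 else C0).

Definition mapply (d : nat) (U : nat -> nat -> C) (v : nat -> C) : nat -> C :=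
  fun i => csum d (fun j => Cmul (U i j) (v j)).

(* the index of |i, b xor x_i, w> for basis index k = |i,b,w> *)
Definition oflip (N : nat) (x : nat -> bool) (k : nat) : nat :=
  if x (k mod N)
  then (if Nat.eqb ((k / N) mod 2) 0 then k + N else k - N)%nat
  else k.

(* oracle O_x : |i,b,w> |-> |i, b xor x_i, w>  (an involution) *)
Definition oracle (N : nat) (x : nat -> bool) (v : nat -> C) : nat -> C :=
  fun k => v (oflip N x k).

Definition e0 : nat -> C := fun k => if Nat.eqb k 0 then C1 else C0.

Fixpoint qrun (N d : nat) (x : nat -> bool) (Us : nat -> nat -> nat -> C) (T : nat)
  : nat -> C :=
  match T with
  | O => mapply d (Us O) e0
  | S T' => mapply d (Us T) (oracle N x (qrun N d x Us T'))
  end.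

(* f is computed with bounded error (<= 1/3 on every input) by some T-query
   algorithm: arbitrary finite workspace m, unitaries U_0..U_T, and a final
   computational-basis measurement whose outcome k is mapped to the output out k. *)
Definition qcomputes (N : nat) (f : (nat -> bool) -> bool) (T : nat) : Prop :=
  exists (m : nat) (Us : nat -> nat -> nat -> C) (out : nat -> bool),
    (1 <= m)%nat /\
    (forall t, (t <= T)%nat -> unitary (dim N m) (Us t)) /\
    forall x : nat -> bool,
      rsum (dim N m) (fun k => if Bool.eqb (out k) (f x) then 0
                               else Cnorm2 (qrun N (dim N m) x Us T k)) <= 1/3.

Definition Q_ge (N : nat) (f : (nat -> bool) -> bool) (r : R) : Prop :=
  forall T : nat, qcomputes N f T -> r <= INR T.

(* Main.v *)
(** Lower bounds come from the positive-weight adversary method in summed form: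
    for pairs (x, y) of inputs with f x <> f y, the total squared distance between
    the states of the algorithm on x and on y starts at 0, ends at 1/9 or more per
    pair, and each query increases it by at most 4 delta per pair, where delta
    bounds the average weighted fraction of pairs that differ at a fixed variable.

    The hard function is surjectivity (Beame and Machmouchi).  Let V be the set of
    k = 2^L bit strings.  The positions are the strings other than [star], in two
    copies; on each copy the carried values form a permutation of V with the image
    of [star] left out, so a value is hit by no position iff both copies miss it.
    Pairs are obtained from an input whose copies both miss c by letting them miss
    distinct values a and b instead.  An input has k (k - 1) partners of which k - 1
    change a given position, and its partners have k of which 1 does: this gives
    k.  Encoding each bit by two blocks of t variables, where the block of the wrong
    value contains a single 0 at a movable place, makes every value test a
    conjunction of variables, so that it merges with the AND of blocks and the
    depth stays 3, and it improves the bound to k sqrt t.  For few gates, OR is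
    used instead. *)
Require Import Defs.
From Stdlib Require Import Reals Lra Lia.
From HB Require Import structures.
From mathcomp Require all_boot all_fingroup.
Open Scope R_scope.

(** * The oracle as a permutation of basis indices *)

Lemma oflip_mod (N : nat) (x : nat -> bool) (k : nat) :
  (0 < N)%nat -> (oflip N x k mod N = k mod N)%nat.
Proof.
intros hN; unfold oflip; destruct (x (k mod N)%nat); trivial.
destruct (Nat.eqb_spec ((k / N) mod 2) 0) as [E|E].
- rewrite <- (Nat.mul_1_l N) at 1; now rewrite Nat.Div0.mod_add.
- assert (h : (N <= k)%nat).
  { destruct (Nat.le_gt_cases N k) as [h|h]; trivial.
    now rewrite Nat.div_small in E. }
  rewrite <- (Nat.Div0.mod_add (k - N) 1 N); f_equal; lia.
Qed.

Lemma oflip_invol (N : nat) (x : nat -> bool) (k : nat) :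
  (0 < N)%nat -> oflip N x (oflip N x k) = k.
Proof.
intros hN; unfold oflip at 1; rewrite oflip_mod by trivial; unfold oflip.
destruct (x (k mod N)%nat); trivial.
pose proof (Nat.div_mod_eq (k / N) 2) as h2.
pose proof (Nat.mod_upper_bound (k / N) 2) as h2'.
destruct (Nat.eqb_spec ((k / N) mod 2) 0) as [E|E].
- replace (k + N)%nat with (k + 1 * N)%nat by lia.
  rewrite Nat.div_add by lia.
  replace ((k / N + 1) mod 2)%nat with 1%nat; [simpl; lia|].
  replace (k / N + 1)%nat with (1 + (k / N / 2) * 2)%nat by lia.
  now rewrite Nat.Div0.mod_add.
- assert (h : (N <= k)%nat).
  { destruct (Nat.le_gt_cases N k) as [h|h]; trivial.
    now rewrite Nat.div_small in E. }
  assert (hd : (k / N = (k - N) / N + 1)%nat).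
  { rewrite <- Nat.div_add by lia; f_equal; lia. }
  replace (((k - N) / N) mod 2)%nat with 0%nat; [simpl; lia|].
  replace ((k - N) / N)%nat with (0 + (k / N / 2) * 2)%nat by lia.
  now rewrite Nat.Div0.mod_add.
Qed.

(** N is added only when k / N is even, which stays within one block of 2N indices. *)
Lemma oflip_lt (N m : nat) (x : nat -> bool) (k : nat) :
  (0 < N)%nat -> (k < dim N m)%nat -> (oflip N x k < dim N m)%nat.
Proof.
unfold dim, oflip; intros hN hk; destruct (x (k mod N)%nat); trivial.
destruct (Nat.eqb_spec ((k / N) mod 2) 0) as [E|E]; [|lia].
pose proof (Nat.div_mod_eq k N) as h1.
pose proof (Nat.mod_upper_bound k N) as h1'.
pose proof (Nat.div_mod_eq (k / N) 2) as h2.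
set (w := (k / N / 2)%nat) in *.
assert (w < m)%nat by nia.
nia.
Qed.

Lemma oflip_agree (N : nat) (x y : nat -> bool) (k : nat) :
  x (k mod N)%nat = y (k mod N)%nat -> oflip N x k = oflip N y k.
Proof. unfold oflip; now intros ->. Qed.

(** * Weighted bounds on squared distances *)

Definition Csub (u v : Defs.C) : Defs.C := mkC (re u - re v) (im u - im v).

Lemma Cnorm2_ge0 u : 0 <= Cnorm2 u.
Proof. unfold Cnorm2; nra. Qed.

Lemma sub_sq_ub (al a b : R) : 0 < al ->
  (a - b) * (a - b) <= (1 + al) * (a * a) + (1 + / al) * (b * b).
Proof.
intros h; pose proof (Rinv_0_lt_compat _ h).
assert (E : al * / al = 1) by (field; lra).
replace ((1 + al) * (a * a) + (1 + / al) * (b * b))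
  with ((a - b) * (a - b) + / al * (al * a + b) ^ 2) by (field; lra).
pose proof (pow2_ge_0 (al * a + b)); nra.
Qed.

Lemma sub_sq_lb (al a b : R) : 0 < al ->
  (1 - al) * (a * a) + (1 - / al) * (b * b) <= (a - b) * (a - b).
Proof.
intros h; pose proof (Rinv_0_lt_compat _ h).
replace ((a - b) * (a - b))
  with ((1 - al) * (a * a) + (1 - / al) * (b * b) + / al * (al * a - b) ^ 2)
  by (field; lra).
pose proof (pow2_ge_0 (al * a - b)); nra.
Qed.

Lemma Csub_norm2_ub (al : R) (u v : Defs.C) : 0 < al ->
  Cnorm2 (Csub u v) <= (1 + al) * Cnorm2 u + (1 + / al) * Cnorm2 v.
Proof.
intros h; unfold Cnorm2, Csub; simpl.
pose proof (sub_sq_ub al (re u) (re v) h); pose proof (sub_sq_ub al (im u) (im v) h).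
lra.
Qed.

Lemma Csub_norm2_lb (al : R) (u v : Defs.C) : 0 < al ->
  (1 - al) * Cnorm2 u + (1 - / al) * Cnorm2 v <= Cnorm2 (Csub u v).
Proof.
intros h; unfold Cnorm2, Csub; simpl.
pose proof (sub_sq_lb al (re u) (re v) h); pose proof (sub_sq_lb al (im u) (im v) h).
lra.
Qed.

Section QueryLowerBound.
Import all_boot all_fingroup.
#[local] Set Implicit Arguments.
#[local] Unset Strict Implicit.

Local Open Scope R_scope.

(** * Real sums, norms and unitary maps *)

HB.instance Definition _ := Monoid.isComLaw.Build R 0 Rplus
  (fun x y z => esym (Rplus_assoc x y z)) Rplus_comm Rplus_0_l.
HB.instance Definition _ := Monoid.isMulLaw.Build R 0 Rmult Rmult_0_l Rmult_0_r.
HB.instance Definition _ := Monoid.isAddLaw.Build R Rmult Rplus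
  Rmult_plus_distr_r Rmult_plus_distr_l.

Local Notation "\rsum_ ( i | P ) F" := (\big[Rplus/0]_(i | P%B) F)
  (at level 36, F at level 36, i at level 50, format "\rsum_ ( i  |  P )  F").
Local Notation "\rsum_ ( i < n ) F" := (\big[Rplus/0]_(i < n) F)
  (at level 36, F at level 36, i, n at level 50, format "\rsum_ ( i  <  n )  F").
Local Notation "\rsum_ ( i < n | P ) F" := (\big[Rplus/0]_(i < n | P%B) F)
  (at level 36, F at level 36, i, n at level 50, format "\rsum_ ( i  <  n  |  P )  F").
Local Notation "\rsum_ ( i : T | P ) F" := (\big[Rplus/0]_(i : T | P%B) F)
  (at level 36, F at level 36, i, T at level 50, format "\rsum_ ( i  :  T  |  P )  F").

Lemma rsum_big (n : nat) F : rsum n F = \rsum_(i < n) F i.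
Proof. by elim: n => [|n IH]; rewrite ?big_ord0 // big_ord_recr /= IH. Qed.

Lemma ler_rsum (I : finType) (P : pred I) (F G : I -> R) :
  (forall i, P i -> F i <= G i) -> \rsum_(i | P i) F i <= \rsum_(i | P i) G i.
Proof.
move=> h; apply: (big_ind2 (fun a b => a <= b)) => //; first exact: Rle_refl.
by move=> *; apply: Rplus_le_compat.
Qed.

Lemma rsum_ge0 (I : finType) (P : pred I) (F : I -> R) :
  (forall i, P i -> 0 <= F i) -> 0 <= \rsum_(i | P i) F i.
Proof.
move=> h; apply: (big_ind (fun a => 0 <= a)) => //; first exact: Rle_refl.
by move=> *; apply: Rplus_le_le_0_compat.
Qed.

Lemma rsum_const (I : finType) (P : pred I) (c : R) :
  \rsum_(i | P i) c = INR #|P| * c.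
Proof.
rewrite big_const; elim: #|P| => [|n IH]; first by rewrite Rmult_0_l.
by rewrite iterS IH S_INR; ring.
Qed.

Lemma csum_big n F :
  csum n F = mkC (\rsum_(i < n) re (F i)) (\rsum_(i < n) im (F i)).
Proof.
by elim: n => [|n IH] /=; rewrite ?big_ord0 // !big_ord_recr /= IH.
Qed.

Definition norm2 d (v : nat -> Defs.C) : R := \rsum_(k < d) Cnorm2 (v k).
Definition vsub (v w : nat -> Defs.C) : nat -> Defs.C := fun k => Csub (v k) (w k).

Lemma norm2_ext d v w : (forall k, (k < d)%N -> v k = w k) -> norm2 d v = norm2 d w.
Proof. by move=> h; apply: eq_bigr => i _; rewrite h. Qed.

Lemma unitaryP d U (j k : 'I_d) : unitary d U ->
  \rsum_(i < d) (re (U i j) * re (U i k) + im (U i j) * im (U i k)) =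
    (if j == k then 1 else 0) /\
  \rsum_(i < d) (re (U i j) * im (U i k) - im (U i j) * re (U i k)) = 0.
Proof.
move=> hU; have := hU j k (ltP (ltn_ord j)) (ltP (ltn_ord k)).
have -> : Nat.eqb j k = (j == k).
  by apply/Nat.eqb_spec/eqP => [/val_inj|->].
rewrite csum_big.
have -> : (if j == k then Defs.C1 else Defs.C0) = mkC (if j == k then 1 else 0) 0 by case: ifP.
case=> <- e; split; last rewrite -[RHS]e; by apply: eq_bigr => i _ /=; ring.
Qed.

Lemma norm2_mapply d U v : unitary d U -> norm2 d (mapply d U v) = norm2 d v.
Proof.
move=> hU.
(* Grouped by the real and imaginary parts of conj(U i j) U i k, so that summing over i first gives
   inner products of columns. *)
have E i : Cnorm2 (mapply d U v i) = \rsum_(j < d) \rsum_(k < d)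
   ((re (U i j) * re (U i k) + im (U i j) * im (U i k)) *
      (re (v j) * re (v k) + im (v j) * im (v k)) +
    (re (U i j) * im (U i k) - im (U i j) * re (U i k)) *
      (im (v j) * re (v k) - re (v j) * im (v k))).
  rewrite /mapply csum_big /Cnorm2 /= !big_distrlr /= -big_split /=.
  apply: eq_bigr => j _; rewrite -big_split /=; apply: eq_bigr => k _; ring.
rewrite /norm2 (eq_bigr _ (fun (i : 'I_d) _ => E i)) exchange_big /=.
apply: eq_bigr => j _; rewrite exchange_big /=.
rewrite (eq_bigr (fun k : 'I_d => if k == j then Cnorm2 (v j) else 0)) => [|k _].
  by rewrite -big_mkcond big_pred1_eq.
have [h1 h2] := unitaryP j k hU.
rewrite big_split -!big_distrl /= h1 h2 eq_sym /Cnorm2.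
by case: eqP => [->|_]; ring.
Qed.

Lemma vsub_mapply d U v w k :
  vsub (mapply d U v) (mapply d U w) k = mapply d U (vsub v w) k.
Proof.
rewrite /vsub /mapply !csum_big /Csub /=; congr mkC.
  (* The negation becomes a factor -1, which distributes over the sum. *)
  rewrite /Rminus -[Ropp (\big[_/_]_(_ < _) _)]Rmult_1_l -Ropp_mult_distr_r Ropp_mult_distr_l.
  by rewrite big_distrr -big_split; apply: eq_bigr => j _ /=; ring.
rewrite /Rminus -[Ropp (\big[_/_]_(_ < _) _)]Rmult_1_l -Ropp_mult_distr_r Ropp_mult_distr_l.
by rewrite big_distrr -big_split; apply: eq_bigr => j _ /=; ring.
Qed.

(** * The effect of one query *)

Section Oracle.
Variables (N m : nat).
Hypothesis N0 : (0 < N)%N.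
Let d := dim N m.

Definition ord_oflip (x : nat -> bool) (k : 'I_d) : 'I_d :=
  Ordinal (introT ltP (oflip_lt N m x k (elimT ltP N0) (elimT ltP (ltn_ord k)))).

Lemma ord_oflipK x : involutive (ord_oflip x).
Proof. by move=> k; apply/val_inj/oflip_invol/ltP. Qed.

(** [oflip] is an involution that keeps the queried index [k mod N], so it permutes any set of basis
    states selected by that index. *)
Lemma reindex_oflip x (P : pred nat) (F : nat -> R) :
  \rsum_(k < d | P (k mod N)%coq_nat) F (oflip N x k) =
  \rsum_(k < d | P (k mod N)%coq_nat) F k.
Proof.
rewrite [RHS](reindex_inj (inv_inj (ord_oflipK x))) /=.
by apply: eq_bigl => k /=; rewrite oflip_mod //; apply/ltP.
Qed.
Lemma norm2_oracle x v : norm2 d (oracle N x v) = norm2 d v.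
Proof. exact: (reindex_oflip x (fun _ => true) (fun k => Cnorm2 (v k))). Qed.

(** Where x and y agree, both oracles permute the basis alike and the distance is kept. Elsewhere
    the upper bound after the query, minus the lower bound before it, leaves (1 + al) - (1 - al) = 2
    al on v, and likewise 2 / al on w. *)
Lemma oracle_dist x y v w (al : nat -> R) : (forall i, 0 < al i) ->
  norm2 d (vsub (oracle N x v) (oracle N y w)) <= norm2 d (vsub v w) +
  \rsum_(k < d | x (k mod N)%coq_nat != y (k mod N)%coq_nat)
    (2 * (al (k mod N)%coq_nat * Cnorm2 (v k) +
          / al (k mod N)%coq_nat * Cnorm2 (w k))).
Proof.
move=> al0; pose A k := x (k mod N)%coq_nat == y (k mod N)%coq_nat.
rewrite /norm2 (bigID (fun k : 'I_d => A k)) /= [X in _ <= X + _](bigID (fun k : 'I_d => A k)) /=.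
rewrite Rplus_assoc; apply: Rplus_le_compat.
  apply: Req_le; rewrite -(reindex_oflip x (fun i => x i == y i)
    (fun k => Cnorm2 (Csub (v k) (w k)))).
  by apply: eq_bigr => k /eqP Ak; rewrite /vsub /oracle (oflip_agree N x y).
pose B i := ~~ (x i == y i).
pose F k := (1 + al (k mod N)%coq_nat) * Cnorm2 (v k).
pose G k := (1 + / al (k mod N)%coq_nat) * Cnorm2 (w k).
apply: (Rle_trans _ (\rsum_(k < d | B (k mod N)%coq_nat) F (oflip N x k) +
                     \rsum_(k < d | B (k mod N)%coq_nat) G (oflip N y k))).
  rewrite -big_split; apply: ler_rsum => k _ /=.
  rewrite /F /G !oflip_mod; try exact/ltP.
  exact: Csub_norm2_ub.
rewrite !reindex_oflip -!big_split; apply: ler_rsum => k _ /=.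
have := Csub_norm2_lb _ (v k) (w k) (al0 (k mod N)%coq_nat).
by rewrite /F /G /vsub; lra.
Qed.

Lemma norm2_qrun x Us T : (0 < m)%N ->
  (forall t, (t <= T)%coq_nat -> unitary d (Us t)) -> norm2 d (qrun N d x Us T) = 1.
Proof.
move=> m0; elim: T => [|T IH] hU /=; rewrite norm2_mapply; try by apply: hU.
  have d0 : (0 < d)%N by rewrite !muln_gt0 N0 m0.
  rewrite /norm2 (bigD1 (Ordinal d0)) //= big1 => [|k k0]; rewrite /e0 /Cnorm2 /=; first by ring.
  have -> : Nat.eqb k 0 = false by apply/Nat.eqb_neq => e; case/eqP: k0; apply/val_inj.
  by rewrite /=; ring.
by rewrite norm2_oracle IH // => t ht; apply: hU; apply: le_S.
Qed.

End Oracle.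

(** * The adversary bound *)

Lemma final_dist d (f : (nat -> bool) -> bool) (out : nat -> bool) x y v w :
  f x = ~~ f y -> norm2 d v = 1 -> norm2 d w = 1 ->
  rsum d (fun k => if Bool.eqb (out k) (f x) then 0 else Cnorm2 (v k)) <= 1 / 3 ->
  rsum d (fun k => if Bool.eqb (out k) (f y) then 0 else Cnorm2 (w k)) <= 1 / 3 ->
  1 / 9 <= norm2 d (vsub v w).
Proof.
rewrite !rsum_big => fxy v1 w1 hv hw.
pose ev k := if Bool.eqb (out k) (f x) then 0 else Cnorm2 (v k).
pose ew k := if Bool.eqb (out k) (f y) then 0 else Cnorm2 (w k).
have : \rsum_(k < d) (1 / 3 * Cnorm2 (v k) + 1 / 3 * Cnorm2 (w k)) <=
  norm2 d (vsub v w) + \rsum_(k < d) (5 / 6 * ev k + 5 / 6 * ew k).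
  rewrite /norm2 -big_split; apply: ler_rsum => k _ /=.
  (* Parameters 3/2 and 2/3 give 2/3 minus 5/6 of the total error, which is at least 2/3 - 5/9. *)
  rewrite /vsub /ev /ew fxy; case: (out k); case: (f y) => /=.
  - have := Csub_norm2_lb (3 / 2) (v k) (w k); lra.
  - have := Csub_norm2_lb (2 / 3) (v k) (w k); lra.
  - have := Csub_norm2_lb (2 / 3) (v k) (w k); lra.
  - have := Csub_norm2_lb (3 / 2) (v k) (w k); lra.
rewrite !big_split -!big_distrr /=.
rewrite -/(norm2 d v) -/(norm2 d w) v1 w1 => h.
have {}h : 1 / 3 * 1 + 1 / 3 * 1 <= norm2 d (vsub v w) +
  (5 / 6 * \rsum_(k < d) ev k + 5 / 6 * \rsum_(k < d) ew k) := h.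
have {}hv : \rsum_(k < d) ev k <= 1 / 3 := hv.
have {}hw : \rsum_(k < d) ew k <= 1 / 3 := hw.
lra.
Qed.

(** The hypotheses allow any nonnegative q because they are applied to the squared modulus of a
    single amplitude, seen as a function of the input. The constant 36 is the growth 4 per query
    divided by the final 1 / 9. *)
Theorem adversary (N T : nat) (f : (nat -> bool) -> bool) (Om : finType) (P : pred Om)
    (x y : Om -> nat -> bool) (al : Om -> nat -> R) (delta : R) :
  (0 < N)%N -> (forall o i, 0 < al o i) ->
  (forall o, P o -> f (x o) = ~~ f (y o)) ->
  (forall i (q : (nat -> bool) -> R), (forall z, 0 <= q z) ->
     \rsum_(o | P o && (x o i != y o i)) (al o i * q (x o)) <=
     delta * \rsum_(o | P o) q (x o)) ->
  (forall i (q : (nat -> bool) -> R), (forall z, 0 <= q z) ->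
     \rsum_(o | P o && (x o i != y o i)) (/ al o i * q (y o)) <=
     delta * \rsum_(o | P o) q (y o)) ->
  qcomputes N f T -> INR #|P| <= 36 * delta * INR T * INR #|P|.
Proof.
move=> N0 al0 fxy hx hy [m [Us [out [/leP m0 [hU err]]]]].
set d := dim N m in hU err.
pose D t := \rsum_(o | P o) norm2 d (vsub (qrun N d (x o) Us t) (qrun N d (y o) Us t)).
have one z t : (t <= T)%coq_nat -> norm2 d (qrun N d z Us t) = 1.
  by move=> tT; apply: norm2_qrun => // s st; apply: hU; apply: Nat.le_trans tT.
have DT : INR #|P| * (1 / 9) <= D T.
  rewrite -rsum_const; apply: ler_rsum => o Po.
  by apply: (final_dist (fxy o Po)); rewrite ?one //; apply: err.
have step t : (t.+1 <= T)%coq_nat -> D t.+1 <= D t + 4 * delta * INR #|P|.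
  move=> tT; have tT' : (t <= T)%coq_nat by lia.
  pose A o := qrun N d (x o) Us t; pose B o := qrun N d (y o) Us t.
  apply: (Rle_trans _ (D t + \rsum_(o | P o) \rsum_(k < d | x o (k mod N)%coq_nat != y o (k mod N)%coq_nat)
    (2 * (al o (k mod N)%coq_nat * Cnorm2 (A o k) + / al o (k mod N)%coq_nat * Cnorm2 (B o k))))).
    rewrite -big_split; apply: ler_rsum => o _ /=.
    rewrite (@norm2_ext _ _ (mapply d (Us t.+1) (vsub (oracle N (x o) (A o)) (oracle N (y o) (B o))))).
      by rewrite norm2_mapply; [apply: oracle_dist | apply: hU].
    by move=> k _; apply: vsub_mapply.
  apply: Rplus_le_compat_l.
  under eq_bigr => o Po do rewrite big_mkcond /=.
  rewrite exchange_big /=.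
  apply: (Rle_trans _ (\rsum_(k < d) (2 * (delta * \rsum_(o | P o) Cnorm2 (A o k) +
                                          delta * \rsum_(o | P o) Cnorm2 (B o k))))).
    apply: ler_rsum => k _.
    rewrite -big_mkcondr -big_distrr big_split /=.
    apply: Rmult_le_compat_l; first lra.
    by apply: Rplus_le_compat;
      [apply: (hx _ (fun z => Cnorm2 (qrun N d z Us t k)))
      | apply: (hy _ (fun z => Cnorm2 (qrun N d z Us t k)))] => z; apply: Cnorm2_ge0.
  have tot z : \rsum_(k < d) \rsum_(o | P o) Cnorm2 (qrun N d (z o) Us t k) = INR #|P|.
    rewrite exchange_big /= (eq_bigr (fun => 1)) => [|o _]; last exact: one.
    by rewrite rsum_const Rmult_1_r.
  rewrite -big_distrr big_split -!big_distrr /= (tot x) (tot y); lra.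
have bound t : (t <= T)%coq_nat -> D t <= INR t * (4 * delta * INR #|P|).
  elim: t => [_|t IH tT].
    rewrite /D big1 => [|o _]; first by rewrite /=; lra.
    by rewrite /norm2 big1 // => k _; rewrite /vsub /Cnorm2 /Csub /=; ring.
  rewrite S_INR; have := step _ tT; have := IH _; move/(_ ltac:(lia)); lra.
by have := bound T (Nat.le_refl _); lra.
Qed.

(** * Formulas whose layers are uniform *)

Lemma feval_and x l : feval x (FAnd l) = all (feval x) l.
Proof. by elim: l => //= g l ->. Qed.

Lemma feval_or x l : feval x (FOr l) = has (feval x) l.
Proof. by elim: l => //= g l ->. Qed.

Section UniformGates.
Variables (I : eqType) (F : I -> formula) (s : seq I).

Lemma fsize_map (c : nat) : (forall i, fsize (F i) = c) ->
  fsize (FAnd [seq F i | i <- s]) = (size s * c)%N /\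
  fsize (FOr [seq F i | i <- s]) = (size s * c)%N.
Proof. by move=> h; split; elim: s => //= i r ->; rewrite h. Qed.

Lemma fgates_map (c : nat) : (forall i, fgates (F i) = c) ->
  fgates (FAnd [seq F i | i <- s]) = (size s * c).+1 /\
  fgates (FOr [seq F i | i <- s]) = (size s * c).+1.
Proof. by move=> h; split; elim: s => //= i r [->]; rewrite h. Qed.

Lemma fdepth_map (c : nat) : (forall i, (fdepth (F i) <= c)%coq_nat) ->
  (fdepth (FAnd [seq F i | i <- s]) <= c.+1)%coq_nat /\
  (fdepth (FOr [seq F i | i <- s]) <= c.+1)%coq_nat.
Proof. by move=> h; split; elim: s => /= [|i r]; have := h; [lia | move/(_ i); lia | lia | move/(_ i); lia]. Qed.

Lemma fwf_map N : (0 < size s)%N -> (forall i, fwf N (F i)) ->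
  fwf N (FAnd [seq F i | i <- s]) /\ fwf N (FOr [seq F i | i <- s]).
Proof.
move=> s0 h; split; split; try by case: s s0.
  by elim: {s0}s => //= i r ?; split.
by elim: {s0}s => //= i r ?; split.
Qed.

End UniformGates.

(** * Surjectivity inputs and the moves between them *)

Section Surjectivity.
Variables (L t : nat).
Local Notation V := {ffun 'I_L -> bool}.
Local Notation nV := (2 ^ L)%N.
Definition star : V := [ffun => false].

(* One half of the positions: position k <> star carries the value s.1 k, and
   s.2 k locates the zeros in its groups of variables. *)
Local Notation side := ({perm V} * {ffun V -> 'I_t})%type.
Local Notation move := (V * 'I_t)%type.
Local Notation var := (bool * V * ('I_L * bool * 'I_t))%type.

(** The block of a bit and a candidate value j.1.2 is all 1 if that value is right, and otherwise
    has its only 0 at place [s.2 k]. The variables at [star] are constantly true, so that the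
    variables form a plain product type. *)
Definition bit_of (s : side) (k : V) (j : 'I_L * bool * 'I_t) : bool :=
  [|| k == star, j.1.2 == s.1 k j.1.1 | j.2 != s.2 k].

Definition missed (s : side) : V := s.1 star.

(* The missed value and e.1 exchange their roles, and the position which carried
   e.1 relocates its zeros to e.2. *)
Definition moved (s : side) (e : move) : side :=
  ((s.1 * tperm e.1 (missed s))%g,
   [ffun k => if k == (s.1^-1)%g e.1 then e.2 else s.2 k]).

(** The reverse move: it restores the missed value and the old place of the zeros at the one
    position that was relocated. *)
Definition undo (s : side) (e : move) : move := (missed s, s.2 ((s.1^-1)%g e.1)).

Lemma missed_moved s e : missed (moved s e) = e.1.
Proof. by rewrite /missed /= permM tpermR. Qed.

Lemma moved_undo s e : moved (moved s e) (undo s e) = s /\ undo (moved s e) (undo s e) = e.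
Proof.
(* Both moves relocate the same position, since the carrier of e.1 now carries the formerly missed
   value. *)
have E : (((moved s e).1)^-1)%g (missed s) = (s.1^-1)%g e.1.
  by apply: (@perm_inj _ (moved s e).1); rewrite permKV /= permM permKV tpermL.
split.
  rewrite {1}/moved missed_moved /undo /= E tpermC -mulgA tperm2 mulg1.
  case: s {E} => p z /=; congr pair; apply/ffunP => k; rewrite !ffunE /=.
  by case: eqP => [->|].
rewrite /undo missed_moved /= E ffunE eqxx.
by case: e {E}.
Qed.

(** Only the position that carried e.1 can change, and a 1 can drop only at the new place of the
    zeros. This asymmetry between 1 and 0 is the source of the factor sqrt t. *)
Lemma moved_bit (s : side) (e : move) k j :
  bit_of s k j != bit_of (moved s e) k j ->
  e.1 = s.1 k /\ (bit_of s k j -> e.2 = j.2).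
Proof.
rewrite /bit_of /= ffunE permM; case: (k =P star) => //= ks H; move: H.
case: (k =P _) => [->|ke].
  rewrite permKV tpermL; case: (j.2 =P e.2) => [->//|_]; rewrite orbT; case: (_ || _) => // _; split.
rewrite tpermD ?eqxx //; first by apply/eqP => e1; apply: ke; rewrite e1 permK.
by apply/eqP => /perm_inj/esym.
Qed.

Local Notation sides := (side * side)%type.
Local Notation moves := (move * move)%type.

(** Indices beyond the variables read true on every input, so they never separate a pair and N may
    be larger. *)
Definition input (p : sides) (i : nat) : bool :=
  if insub i is Some o then
    let v : var := enum_val (o : 'I_#|{: var}|) in
    bit_of (if v.1.1 then p.1 else p.2) v.1.2 v.2
  else true.

Lemma input_rank p (v : var) :
  input p (enum_rank v) = bit_of (if v.1.1 then p.1 else p.2) v.1.2 v.2.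
Proof. by rewrite /input valK /= enum_rankK. Qed.

Definition moved2 (p : sides) (e : moves) : sides := (moved p.1 e.1, moved p.2 e.2).

(** Exchanges the two inputs of a pair, so that the second adversary condition reduces to a count of
    the first kind. *)
Definition flip (o : sides * moves) : sides * moves :=
  (moved2 o.1 o.2, (undo o.1.1 o.2.1, undo o.1.2 o.2.2)).

Lemma flipK : involutive flip.
Proof.
case=> -[s1 s2] [e1 e2]; rewrite /flip /moved2 /=.
by rewrite !(proj1 (moved_undo _ _)) !(proj2 (moved_undo _ _)).
Qed.

Lemma card_move (A : pred V) (B : pred 'I_t) :
  #|[pred e : move | A e.1 && B e.2]| = (#|A| * #|B|)%N.
Proof. by rewrite -cardX; apply: eq_card. Qed.

Lemma card_fst (A : pred V) : #|[pred e : move | A e.1]| = (#|A| * t)%N.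
Proof.
rewrite -[X in (_ * X)%N]card_ord -card_move.
by apply: eq_card => e; rewrite /in_mem /= andbT.
Qed.

(** * Counting the moves that change a given variable *)

Section Counting.
Variables (r : rel V) (n : nat).
Hypothesis (rC : symmetric r) (rn : forall a, #|r a| = n).

Lemma card_rel_moves :
  #|[pred e : moves | r e.1.1 e.2.1]| = (nV * t * (n * t))%N.
Proof.
rewrite -sum1_card -(pair_big_dep predT (fun e1 e2 : move => r e1.1 e2.1) (fun _ _ => 1%N)) /=.
rewrite (eq_bigr (fun => (n * t)%N)) => [|e _].
  by rewrite sum_nat_const card_prod card_ffun !card_ord card_bool.
by rewrite sum1_card (card_fst (r e.1)) rn.
Qed.

(** The half containing the variable must move to the value carried there, and also to the place of
    the variable if it reads 1. The other half then has n t choices. Here [r] relates the new missed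
    values: distinct ones from an input missing a common value, equal ones in the flipped
    direction. *)
Lemma card_differ p i :
  (#|[pred e : moves | r e.1.1 e.2.1 & input p i != input (moved2 p e) i]|
     <= (if input p i then 1 else t) * (n * t))%N.
Proof.
rewrite /input; case: insubP => [o _ _|_]; last first.
  by rewrite eq_card0 // => e; rewrite inE eqxx andbF.
case: (enum_val o) => -[sd k] j /=; set s := if sd then _ else _.
pose A := s.1 k; pose B (e : move) := (e.1 == A) && (bit_of s k j ==> (e.2 == j.2)).
have cB : #|B| = (if bit_of s k j then 1 else t)%N.
  rewrite /B; case: (bit_of s k j) => /=.
    by rewrite -[LHS]/#|[pred e : move | pred1 A e.1 && pred1 j.2 e.2]| card_move !card1.
  by rewrite -[RHS]mul1n -(card1 A) -card_fst; apply: eq_card => e; rewrite /in_mem /= andbT.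
have cC : #|[pred e : move | r A e.1]| = (n * t)%N by rewrite (card_fst (r A)) rn.
rewrite -cB -cC; case: sd @s @A @B {cB cC} => s A B.
  rewrite -cardX; apply/subset_leq_card/subsetP => -[e1 e2] /andP[/= h].
  case/moved_bit => h1 h2; rewrite inE /= !unfold_in /B /A -h1 eqxx h andbT /=.
  by apply/implyP => /h2 ->.
rewrite mulnC -cardX; apply/subset_leq_card/subsetP => -[e1 e2] /andP[/= h].
case/moved_bit => h1 h2; rewrite inE /= !unfold_in /B /A -h1 eqxx rC h /=.
by apply/implyP => /h2 ->.
Qed.

(** Changing moves form a fraction of at most 1 / (nV t) at a 1 and 1 / nV at a 0; the weight brings
    both to 1 / (nV sqrt t). *)
Definition weight (b : bool) : R := if b then sqrt (INR t) else / sqrt (INR t).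

Lemma weight_differ p i : (0 < t)%N ->
  INR #|[pred e : moves | r e.1.1 e.2.1 & input p i != input (moved2 p e) i]| *
    weight (input p i) <=
  / (INR nV * sqrt (INR t)) * INR #|[pred e : moves | r e.1.1 e.2.1]|.
Proof.
move=> t0; have c := card_differ p i; rewrite card_rel_moves.
have st : 0 < sqrt (INR t) by apply/sqrt_lt_R0/lt_0_INR/ltP.
have tE : INR t = sqrt (INR t) * sqrt (INR t) by rewrite sqrt_sqrt //; apply: pos_INR.
have r0 : 0 < INR nV by apply/lt_0_INR/ltP; rewrite expn_gt0.
have w0 : 0 < weight (input p i).
  by rewrite /weight; case: ifP => _ //; apply: Rinv_0_lt_compat.
apply: (Rle_trans _ _ _ (Rmult_le_compat_r _ _ _ (Rlt_le _ _ w0) (le_INR _ _ (leP c)))).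
apply: Req_le; rewrite /weight !mult_INR; move: st tE; set q := sqrt _ => st tE.
by case: (input p i); rewrite ?[INR 1]/= tE; field; lra.
Qed.

End Counting.

Lemma weight_gt0 b : (0 < t)%N -> 0 < weight b.
Proof.
move=> t0; have st : 0 < sqrt (INR t) by apply/sqrt_lt_R0/lt_0_INR/ltP.
by case: b => //=; apply: Rinv_0_lt_compat.
Qed.

Lemma weight_sum (A : pred sides) (r : rel V) (n i : nat) (q : (nat -> bool) -> R) :
  (0 < t)%N -> symmetric r -> (forall a, #|r a| = n) -> (forall z, 0 <= q z) ->
  \rsum_(o : sides * moves | A o.1 && r o.2.1.1 o.2.2.1 &&
                             (input o.1 i != input (moved2 o.1 o.2) i))
     (weight (input o.1 i) * q (input o.1)) <=
  / (INR nV * sqrt (INR t)) *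
  \rsum_(o : sides * moves | A o.1 && r o.2.1.1 o.2.2.1) q (input o.1).
Proof.
move=> t0 rC rn q0.
under eq_bigl => o do rewrite -andbA.
rewrite -(pair_big_dep A (fun p e => r e.1.1 e.2.1 && (input p i != input (moved2 p e) i))
  (fun p _ => weight (input p i) * q (input p))).
rewrite -(pair_big_dep A (fun p (e : moves) => r e.1.1 e.2.1) (fun p _ => q (input p))).
rewrite big_distrr /=; apply: ler_rsum => p _.
rewrite !rsum_const -!Rmult_assoc; apply: Rmult_le_compat_r => //.
exact: (weight_differ rC rn).
Qed.

Lemma surj_adversary (N T : nat) (f : (nat -> bool) -> bool) :
  (0 < N)%N -> (0 < L)%N -> (0 < t)%N ->
  (forall p, f (input p) = (missed p.1 != missed p.2)) ->
  qcomputes N f T -> INR nV * sqrt (INR t) <= 36 * INR T.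
Proof.
move=> N0 L0 t0 hf hT; set K := INR nV * sqrt (INR t).
have K0 : 0 < K.
  apply: Rmult_lt_0_compat; last by apply/sqrt_lt_R0/lt_0_INR/ltP.
  by apply/lt_0_INR/ltP; rewrite expn_gt0.
pose P (o : sides * moves) := (missed o.1.1 == missed o.1.2) && (o.2.1.1 != o.2.2.1).
have cne (a : V) : #|[rel x y : V | x != y] a| = nV.-1.
  have := cardC (pred1 a); rewrite card1 card_ffun card_bool card_ord => <-.
  by apply: eq_card => b; rewrite !inE eq_sym.
have ceq (a : V) : #|[rel x y : V | x == y] a| = 1%N.
  by rewrite -(card1 a); apply: eq_card => b; rewrite !inE eq_sym.
have Pflip o : P (flip o) = (missed o.1.1 != missed o.1.2) && (o.2.1.1 == o.2.2.1).
  by rewrite /P /= !missed_moved andbC.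
(* Some pair must exist for the bound to say anything; it uses L > 0 to have two distinct values. *)
have P0 : 0 < INR #|P|.
  have z0 : 'I_t := Ordinal t0.
  pose s : side := (1%g, [ffun => z0]).
  apply/lt_0_INR/ltP/card_gt0P.
  exists ((s, s), ((star, z0), ([ffun => true], z0))).
  rewrite unfold_in /P /= eqxx; apply/eqP => /ffunP/(_ (Ordinal L0)).
  by rewrite !ffunE.
have : INR #|P| <= 36 * / K * INR T * INR #|P|.
  apply: (@adversary N T f _ P (fun o => input o.1) (fun o => input (flip o).1)
    (fun o i => weight (input o.1 i))) => // [o i|o|i q q0|i q q0].
  - exact: weight_gt0.
  - by case/andP => h h'; rewrite !hf /= !missed_moved h h'.
  - by apply: (weight_sum (fun p => missed p.1 == missed p.2) i t0 _ cne) => // a b;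
      rewrite /= eq_sym.
  - have := weight_sum (fun p => missed p.1 != missed p.2) i t0 _ ceq q0.
    move/(_ (fun a b => eq_sym a b)); rewrite -/K.
    rewrite [X in _ -> X <= _](reindex_inj (inv_inj flipK)).
    rewrite [X in _ -> _ <= _ * X](reindex_inj (inv_inj flipK)).
    congr (_ <= _ * _); last by apply: eq_big => [o|o _]; rewrite ?Pflip ?flipK.
    apply: eq_big => [o|o /andP[_ d]]; rewrite flipK.
      by rewrite Pflip (eq_sym (input (flip o).1 i)).
    (* The two inputs differ at i, so the inverse weight of one is the weight of the other. *)
    move: d; rewrite /= /weight.
    by do 2!case: (input _ _); rewrite ?Rinv_inv.
move=> h; have {}h : 1 <= 36 * / K * INR T by nra.
have -> : 36 * INR T = K * (36 * / K * INR T) by field; lra.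
by nra.
Qed.

(** * The depth three formula for surjectivity *)

Definition surj_term (r : V) (pos : bool * V) : formula :=
  FAnd [seq Lit (enum_rank (pos, (j.1, r j.1, j.2))) true | j <- enum {: 'I_L * 'I_t}].

Definition surj_clause (r : V) : formula :=
  FOr [seq surj_term r pos | pos <- enum [pred pos : bool * V | pos.2 != star]].

Definition surj_formula : formula := FAnd [seq surj_clause r | r <- enum {: V}].

Lemma surj_term_eval p r pos : (0 < t)%N -> pos.2 != star ->
  feval (input p) (surj_term r pos) = ((if pos.1 then p.1 else p.2).1 pos.2 == r).
Proof.
move=> t0 ps; rewrite feval_and all_map.
set s := if pos.1 then p.1 else p.2.
have E j : (feval (input p) \o (fun j => Lit (enum_rank (pos, (j.1, r j.1, j.2))) true)) j =
    (r j.1 == s.1 pos.2 j.1) || (j.2 != s.2 pos.2).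
  by rewrite /= input_rank /bit_of /= (negbTE ps).
rewrite (eq_all E); apply/allP/eqP => [h|-> j _]; last by rewrite eqxx.
(* For bit b, the variable at the place of the zero is the one that decides. *)
apply/ffunP => b; have := h (b, s.2 pos.2); rewrite mem_enum => /(_ isT).
by rewrite /= eqxx orbF => /eqP.
Qed.

Lemma surj_formula_eval p : (0 < t)%N ->
  feval (input p) surj_formula = (missed p.1 != missed p.2).
Proof.
move=> t0; rewrite feval_and all_map; apply/allP/idP => [h|ne r _].
  apply/negP => /eqP e; have := h (missed p.1); rewrite mem_enum => /(_ isT).
  rewrite [preim _ _ _]feval_or has_map => /hasP[pos]; rewrite mem_enum inE => ps.
  rewrite [preim _ _ _]surj_term_eval //; case: pos.1; last rewrite e.
    by rewrite (inj_eq perm_inj) => /eqP ps'; rewrite ps' eqxx in ps.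
  by rewrite (inj_eq perm_inj) => /eqP ps'; rewrite ps' eqxx in ps.
rewrite [preim _ _ _]feval_or has_map; apply/hasP.
(* A half that does not miss r carries it at a position other than [star]. *)
pose sd := missed p.1 != r; pose s := if sd then p.1 else p.2.
have sr : missed s != r.
  by rewrite /s /sd; case: (missed p.1 =P r) => [<-|/eqP] //; rewrite eq_sym.
have ps : ((s.1)^-1)%g r != star.
  by apply: contraNneq sr => e; rewrite /missed -e permKV.
by exists (sd, ((s.1)^-1)%g r); rewrite ?mem_enum // [preim _ _ _]surj_term_eval //= -/s permKV.
Qed.

Lemma size_surj_pos :
  size (enum [pred pos : bool * V | pos.2 != star]) = (2 * nV.-1)%N.
Proof.
have E : #|predC1 star| = nV.-1.
  have := cardC (pred1 star); rewrite card1 card_ffun card_bool card_ord => <-.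
  exact: eq_card.
rewrite -E -cardE -[2%N]card_bool -cardX.
by apply: eq_card => -[b a]; rewrite !inE.
Qed.

Lemma size_enum_ffun : size (enum {: V}) = nV.
Proof. by rewrite -cardE card_ffun card_bool card_ord. Qed.

(** The variables number 2 halves times nV positions times L bits times 2 values times t places.
    There are nV clauses of 2 (nV - 1) terms with L t literals each. *)
Lemma surj_formula_bounds (N : nat) : (0 < L)%N -> (0 < t)%N ->
  (4 * nV * L * t <= N)%N ->
  [/\ fwf N surj_formula, (fdepth surj_formula <= 3)%coq_nat,
      (fsize surj_formula <= 2 * nV * nV * L * t)%N &
      (fgates surj_formula <= 2 * nV * nV)%N].
Proof.
move=> L0 t0 hN.
have R2 : (2 <= nV)%N by rewrite -[X in (X <= _)%N]expn1 leq_exp2l.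
split.
- apply: (proj1 (fwf_map _ _)); rewrite ?size_enum_ffun ?expn_gt0 // => r.
  apply: (proj2 (fwf_map _ _)) => [|pos].
    by rewrite size_surj_pos muln_gt0 -subn1 subn_gt0.
  apply: (proj1 (fwf_map _ _)) => [|j]; first by rewrite -cardE card_prod !card_ord muln_gt0 L0.
  apply/ltP; apply: leq_trans (ltn_ord _) _; apply: leq_trans hN.
  by rewrite !card_prod card_ffun !card_bool !card_ord; rewrite -!multE; apply: eq_leq; nia.
- apply: (proj1 (fdepth_map _ _)) => r; apply: (proj2 (fdepth_map _ _)) => pos.
  by apply: (proj1 (fdepth_map _ _)) => j; apply: le_n.
- rewrite /surj_formula (proj1 (fsize_map _ (c := (2 * nV.-1 * (L * t))%N) _)); last first.
    move=> r; rewrite /surj_clause (proj2 (fsize_map _ (c := (L * t)%N) _)) ?size_surj_pos // => pos.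
    by rewrite /surj_term (proj1 (fsize_map _ (c := 1%N) _)) // -cardE card_prod !card_ord muln1.
  rewrite size_enum_ffun; case: nV R2 => // n _; apply/leP; rewrite -!multE /=; nia.
- rewrite /surj_formula (proj1 (fgates_map _ (c := (2 * nV.-1).+1) _)); last first.
    move=> r; rewrite /surj_clause (proj2 (fgates_map _ (c := 1%N) _)) ?size_surj_pos ?muln1 // => pos.
    by rewrite /surj_term (proj1 (fgates_map _ (c := 0%N) _)) // muln0.
  rewrite size_enum_ffun; case: nV R2 => // n _; apply/leP; rewrite -!multE /=; nia.
Qed.
End Surjectivity.

(** * Hard formulas with explicit parameters *)

Lemma expn_pow (a b : nat) : (a ^ b)%N = Nat.pow a b.
Proof. by elim: b => // b IH; rewrite expnS IH. Qed.

Lemma surj_hard (N L t : nat) : (1 <= L)%coq_nat -> (1 <= t)%coq_nat ->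
  (4 * Nat.pow 2 L * L * t <= N)%coq_nat ->
  exists F, [/\ fwf N F, (fdepth F <= 3)%coq_nat,
    (fsize F <= 2 * Nat.pow 2 L * Nat.pow 2 L * L * t)%coq_nat,
    (fgates F <= 2 * Nat.pow 2 L * Nat.pow 2 L)%coq_nat &
    forall T, qcomputes N (fun x => feval x F) T ->
      INR (Nat.pow 2 L) * sqrt (INR t) <= 36 * INR T].
Proof.
move=> /leP L0 /leP t0 /leP; rewrite -expn_pow => hN.
have [wf dep sz gt] := surj_formula_bounds L0 t0 hN.
exists (surj_formula L t); split=> // [||T]; try exact/leP.
apply: surj_adversary => // [|p]; last exact: surj_formula_eval.
by apply: leq_trans hN; rewrite !muln_gt0 expn_gt0 L0.
Qed.

(** The zero input is paired with the n inputs having a single 1. One pair in n differs at a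
    variable i < n, while the partner has no other pair; the weight sqrt n balances both sides to 1
    / sqrt n. *)
Lemma or_hard (N n : nat) : (1 <= n)%coq_nat -> (n <= N)%coq_nat ->
  exists F, [/\ fwf N F, (fdepth F <= 3)%coq_nat, fsize F = n, fgates F = 1%N &
    forall T, qcomputes N (fun x => feval x F) T -> sqrt (INR n) <= 36 * INR T].
Proof.
move=> /leP n0 /leP nN; pose F := FOr [seq Lit (val i) true | i <- enum 'I_n].
have N0 : (0 < N)%N by apply: leq_trans nN.
have sn : 0 < sqrt (INR n) by apply/sqrt_lt_R0/lt_0_INR/ltP.
have nE : INR n = sqrt (INR n) * sqrt (INR n) by rewrite sqrt_sqrt //; apply: pos_INR.
have se : size (enum 'I_n) = n by rewrite -cardE card_ord.
have ev x : feval x F = [exists i : 'I_n, x i].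
  rewrite feval_or has_map; apply/hasP/existsP => [[i _ xi]|[i xi]]; exists i => //.
  by rewrite mem_enum.
exists F; split.
- apply: (proj2 (fwf_map _ _)) => [|i]; first by rewrite se.
  by apply/ltP; apply: leq_trans (ltn_ord i) nN.
- by apply: Nat.le_trans (proj2 (fdepth_map _ (c := 0%N) _)) _ => [i|]; [apply: le_n | lia].
- by rewrite (proj2 (fsize_map _ (c := 1%N) _)) // se muln1.
- by rewrite (proj2 (fgates_map _ (c := 0%N) _)) // muln0.
move=> T hT.
have n0' : 0 < INR n by rewrite nE; nra.
have sub i (G : 'I_n -> R) : \rsum_(o : 'I_n | predT o && (false != (i == o :> nat))) G o =
    if insub i is Some o then G o else 0.
  case: insubP => [o _ <-|h].
    by rewrite (big_pred1 o) // => o'; rewrite /= (eq_sym o') -(val_eqE o) /=; case: (_ == _ :> nat).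
  by rewrite big_pred0 // => o /=; case: (i =P o) h => // ->; rewrite ltn_ord.
have : INR #|'I_n| <= 36 * / sqrt (INR n) * INR T * INR #|'I_n|.
  apply: (@adversary N T (fun x => feval x F) 'I_n predT
    (fun _ _ => false) (fun o i => i == o :> nat) (fun _ _ => sqrt (INR n)))
    => // [o _|i q q0|i q q0]; cbv beta.
  - rewrite !ev; have -> : [exists i : 'I_n, i == o :> nat] by apply/existsP; exists o.
    by apply/existsP => -[].
  - rewrite sub rsum_const card_ord.
    have E : / sqrt (INR n) * (INR n * q (fun=> false)) = sqrt (INR n) * q (fun=> false).
      by move: sn nE; set s := sqrt _ => sn nE; rewrite nE; field; lra.
    rewrite E; case: insub => [_|]; first exact: Rle_refl.
    by apply: Rmult_le_pos; [lra | exact: q0].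
  - rewrite sub; have s' := Rinv_0_lt_compat _ sn.
    case: insub => [o|]; last first.
      by apply: Rmult_le_pos; [lra | apply: rsum_ge0].
    apply: Rmult_le_compat_l; first lra.
    rewrite (bigD1 o) //= -[X in X <= _]Rplus_0_r; apply: Rplus_le_compat_l.
    by apply: rsum_ge0.
rewrite card_ord => h; have {}h : 1 <= 36 * / sqrt (INR n) * INR T by nra.
have -> : 36 * INR T = sqrt (INR n) * (36 * / sqrt (INR n) * INR T) by field; lra.
by nra.
Qed.
End QueryLowerBound.

(** * Choice of parameters *)

Definition fits (N S G L : nat) : Prop :=
  (4 * 2 ^ L * L <= N /\ 2 * 2 ^ L * 2 ^ L * L <= S /\ 2 * 2 ^ L * 2 ^ L <= G)%nat.

Lemma fits_max (N S G : nat) : fits N S G 1 ->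
  exists L, (1 <= L)%nat /\ fits N S G L /\ ~ fits N S G (L + 1).
Proof.
intros h1.
assert (h : forall k, (exists L, (1 <= L)%nat /\ fits N S G L /\ ~ fits N S G (L + 1)) \/
                      fits N S G (k + 1)).
{ induction k as [|k [IH|IH]]; [now right|now left|].
  assert (dec : fits N S G (k + 1 + 1) \/ ~ fits N S G (k + 1 + 1)).
  { unfold fits; lia. }
  replace (Datatypes.S k + 1)%nat with (k + 1 + 1)%nat by lia.
  destruct dec as [h|h]; [now right|left; exists (k + 1)%nat; split; [lia|tauto]]. }
(* The search ends by k = N, since 4 * 2^(N+1) * (N+1) exceeds N. *)
destruct (h N) as [|[h' _]]; trivial; exfalso.
assert (0 < 2 ^ (N + 1))%nat by (apply Nat.neq_0_lt_0, Nat.pow_nonzero; lia).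
nia.
Qed.

(* With m the target bound, k = 2 ^ L: the choice of L makes one of the last three bounds fail for L + 1,
   and t is within a factor 2 of the largest admissible one. *)
Lemma parameters_optimal (m N S G L k t : R) :
  0 <= m -> 1 <= L -> 1 <= k -> 1 <= t -> 0 <= N -> 0 <= S -> 0 <= G ->
  m <= N -> m * m <= S -> (m * m) * (m * m) <= N * N * G ->
  N <= 8 * k * L * t \/ S <= 4 * (k * k) * L * t ->
  N <= 16 * k * L \/ S <= 16 * (k * k) * L \/ G <= 8 * (k * k) ->
  m * m <= (12 * L) * (12 * L) * (k * k * t).
Proof.
intros m0 L1 k1 t1 N0 S0 G0 mN mS mG ht hL.
assert (kk : 0 < k * k) by nra.
assert (z0 : 0 < k * k * t) by (apply Rmult_lt_0_compat; lra).
assert (LL : L <= L * L) by nra.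
assert (z1 : L * (k * k * t) <= L * L * (k * k * t)) by (apply Rmult_le_compat_r; lra).
assert (z2 : 0 <= L * (k * k * t)) by nra.
destruct ht as [ht|ht]; [|nra].
destruct hL as [hL|[hL|hL]].
(* N limits both t and L. Here 8 * 16 = 128 <= 12^2 is what fixes the constant 12. *)
- assert (N * N <= (8 * k * L * t) * (16 * k * L)) by (apply Rmult_le_compat; lra).
  assert (m * m <= N * N) by (apply Rmult_le_compat; lra).
  nra.
(* N limits t and S limits L: the fourth power of m is at most N * N * S, and L^3 <= L^4 remains. *)
- assert (NN : N * N <= (8 * k * L * t) * (8 * k * L * t)) by (apply Rmult_le_compat; lra).
  assert (e1 : (m * m) * (m * m) <= ((8 * k * L * t) * (8 * k * L * t)) * (16 * (k * k) * L)).
  { apply Rmult_le_compat; nra. }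
  apply Rsqr_incr_0; [unfold Rsqr|nra|nra].
  apply Rle_trans with (1 := e1).
  assert (L * L * L <= L * L * (L * L)) by (apply Rmult_le_compat_l; nra).
  replace (8 * k * L * t * (8 * k * L * t) * (16 * (k * k) * L))
    with ((k * k * t) * (k * k * t) * (1024 * (L * L * L))) by ring.
  replace (12 * L * (12 * L) * (k * k * t) * (12 * L * (12 * L) * (k * k * t)))
    with ((k * k * t) * (k * k * t) * (20736 * (L * L * (L * L)))) by ring.
  apply Rmult_le_compat_l; nra.
(* N limits t and G limits L: the bound through N * N * G is used, and L^2 <= L^4 remains. *)
- assert (NN : N * N <= (8 * k * L * t) * (8 * k * L * t)) by (apply Rmult_le_compat; lra).
  assert (e1 : (m * m) * (m * m) <= ((8 * k * L * t) * (8 * k * L * t)) * (8 * (k * k))).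
  { apply Rle_trans with (1 := mG); apply Rmult_le_compat; nra. }
  apply Rsqr_incr_0; [unfold Rsqr|nra|nra].
  apply Rle_trans with (1 := e1).
  assert (L * L * 1 <= L * L * (L * L)) by (apply Rmult_le_compat_l; nra).
  replace (8 * k * L * t * (8 * k * L * t) * (8 * (k * k)))
    with ((k * k * t) * (k * k * t) * (512 * (L * L * 1))) by ring.
  replace (12 * L * (12 * L) * (k * k * t) * (12 * L * (12 * L) * (k * k * t)))
    with ((k * k * t) * (k * k * t) * (20736 * (L * L * (L * L)))) by ring.
  apply Rmult_le_compat_l; nra.
Qed.

Section Target.
Variables (N S G : nat).
Hypotheses (N2 : (2 <= N)%nat) (S1 : (1 <= S)%nat) (G1 : (1 <= G)%nat).
Let m := Rmin (INR N) (Rmin (sqrt (INR S)) (sqrt (INR N) * Rpower (INR G) (1 / 4))).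

Lemma target_bounds :
  0 <= m /\ m <= INR N /\ m * m <= INR S /\ (m * m) * (m * m) <= INR N * INR N * INR G.
Proof using N2 S1 G1.
pose proof (pos_INR N) as N0; pose proof (pos_INR S) as S0.
assert (G0 : 0 < INR G) by (apply lt_0_INR; lia).
assert (g0 : 0 < Rpower (INR G) (1 / 4)) by apply exp_pos.
set (g := Rpower (INR G) (1 / 4)) in *.
assert (gE : (g * g) * (g * g) = INR G).
{ unfold g; rewrite <- !Rpower_plus.
  replace (1 / 4 + 1 / 4 + (1 / 4 + 1 / 4)) with 1 by field.
  now apply Rpower_1. }
pose proof (sqrt_pos (INR N)) as sN0; pose proof (sqrt_pos (INR S)) as sS0.
pose proof (sqrt_sqrt _ N0) as sN; pose proof (sqrt_sqrt _ S0) as sS.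
assert (m1 : m <= INR N) by apply Rmin_l.
assert (m2 : m <= sqrt (INR S)) by (eapply Rle_trans; [apply Rmin_r|apply Rmin_l]).
assert (m3 : m <= sqrt (INR N) * g) by (eapply Rle_trans; [apply Rmin_r|apply Rmin_r]).
assert (m0 : 0 <= m) by (repeat apply Rmin_glb; nra).
repeat split; trivial.
- rewrite <- sS; now apply Rmult_le_compat.
- rewrite <- gE, <- sN.
  set (s := sqrt (INR N)) in *.
  replace (s * s * (s * s) * (g * g * (g * g))) with ((s * g * (s * g)) * (s * g * (s * g))) by ring.
  apply Rmult_le_compat; try nra; now apply Rmult_le_compat.
Qed.

(** If S is the minimum, m * m <= S suffices. Otherwise a parameter below 8 costs only a constant
    factor. *)
Lemma or_case : (N < 8 \/ S < 8 \/ G < 8)%nat ->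
  m <= 8 * sqrt (INR (Nat.min N S)).
Proof using N2 S1 G1.
intros h; destruct target_bounds as [m0 [mN [mS mG]]].
set (n := Nat.min N S).
assert (n1 : 1 <= INR n) by (apply (le_INR 1); unfold n; lia).
pose proof (sqrt_pos (INR n)) as s0; pose proof (sqrt_sqrt (INR n) ltac:(lra)) as sE.
apply Rsqr_incr_0; [unfold Rsqr|trivial|lra].
assert (E : INR n = INR N \/ INR n = INR S) by (unfold n; destruct (Nat.min_dec N S) as [->| ->]; auto).
assert (N1 : 1 <= INR N) by (apply (le_INR 1); lia).
destruct h as [h|[h|h]]; apply lt_INR in h; simpl in h.
- nra.
- nra.
- destruct E as [E|E]; [|nra].
  apply Rsqr_incr_0; [unfold Rsqr|nra|nra].
  apply Rle_trans with (1 := mG).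
  set (s := sqrt (INR n)) in *.
  replace (8 * s * (8 * s) * (8 * s * (8 * s)))
    with (4096 * (INR n * INR n)) by (rewrite <- sE; ring).
  rewrite E; nra.
Qed.

(** The threshold 8 is what [fits] demands of each parameter at L = 1. *)
Lemma surj_case : (8 <= N)%nat -> (8 <= S)%nat -> (8 <= G)%nat ->
  exists L t, (1 <= L)%nat /\ (1 <= t)%nat /\ (4 * 2 ^ L * L * t <= N)%nat /\
    (2 * 2 ^ L * 2 ^ L * L * t <= S)%nat /\ (2 * 2 ^ L * 2 ^ L <= G)%nat /\
    m <= 12 * INR L * (INR (2 ^ L) * sqrt (INR t)).
Proof using N2 S1 G1.
intros N8 S8 G8.
destruct (fits_max N S G) as [L [L1 [[h1 [h2 h3]] hmax]]]; [unfold fits; simpl; lia|].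
unfold fits in hmax; rewrite Nat.pow_add_r in hmax; change (2 ^ 1)%nat with 2%nat in hmax.
assert (k0 : (1 <= 2 ^ L)%nat) by (pose proof (Nat.pow_nonzero 2 L); lia).
exists L; set (k := (2 ^ L)%nat) in *.
(* The number of variables and the size, per unit of t. *)
set (a := (4 * k * L)%nat) in *; set (b := (2 * k * k * L)%nat) in *.
assert (a0 : (0 < a)%nat) by (unfold a; nia).
assert (b0 : (0 < b)%nat) by (unfold b; nia).
set (t := Nat.min (N / a) (S / b)).
pose proof (Nat.mul_div_le N a ltac:(lia)) as na.
pose proof (Nat.mul_div_le S b ltac:(lia)) as sb.
pose proof (Nat.mul_succ_div_gt N a ltac:(lia)) as na'.
pose proof (Nat.mul_succ_div_gt S b ltac:(lia)) as sb'.
assert (na1 : (1 <= N / a)%nat) by (apply Nat.div_str_pos; lia).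
assert (sb1 : (1 <= S / b)%nat) by (apply Nat.div_str_pos; lia).
assert (t1 : (1 <= t)%nat) by (unfold t; lia).
assert (hN : (a * t <= N)%nat).
{ apply Nat.le_trans with (2 := na), Nat.mul_le_mono_l; unfold t; lia. }
assert (hS : (b * t <= S)%nat).
{ apply Nat.le_trans with (2 := sb), Nat.mul_le_mono_l; unfold t; lia. }
exists t; do 5 (split; [assumption|]).
destruct target_bounds as [m0 [mN [mS mG]]].
assert (T1 : 1 <= INR t) by (now apply (le_INR 1)).
assert (L1' : 1 <= INR L) by (now apply (le_INR 1)).
assert (k1' : 1 <= INR k) by (now apply (le_INR 1)).
pose proof (sqrt_sqrt (INR t) ltac:(lra)) as sE.
pose proof (sqrt_pos (INR t)) as s0.
apply Rsqr_incr_0; [unfold Rsqr|trivial|repeat apply Rmult_le_pos; lra].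
set (s := sqrt (INR t)) in *.
replace (12 * INR L * (INR k * s) * (12 * INR L * (INR k * s)))
  with (12 * INR L * (12 * INR L) * (INR k * INR k * INR t)) by (rewrite <- sE; ring).
apply parameters_optimal with (INR N) (INR S) (INR G); trivial; try apply pos_INR.
(* Rounding down loses at most a factor 2, since t + 1 <= 2 t. *)
- destruct (Nat.min_dec (N / a) (S / b)) as [e|e]; fold t in e; [left|right].
  + replace (8 * INR k * INR L * INR t) with (INR (8 * k * L * t)) by (rewrite !mult_INR; simpl; ring).
    apply le_INR, Nat.lt_le_incl; rewrite <- e in na'.
    apply Nat.lt_le_trans with (1 := na').
    replace (8 * k * L * t)%nat with (a * (2 * t))%nat by (unfold a; ring).
    apply Nat.mul_le_mono_l; lia.
  + replace (4 * (INR k * INR k) * INR L * INR t) with (INR (4 * (k * k) * L * t)) by (rewrite !mult_INR; simpl; ring).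
    apply le_INR, Nat.lt_le_incl; rewrite <- e in sb'.
    apply Nat.lt_le_trans with (1 := sb').
    replace (4 * (k * k) * L * t)%nat with (b * (2 * t))%nat by (unfold b; ring).
    apply Nat.mul_le_mono_l; lia.
- replace (16 * INR k * INR L) with (INR (16 * k * L)) by (rewrite !mult_INR; simpl; ring).
  replace (16 * (INR k * INR k) * INR L) with (INR (16 * (k * k) * L)) by (rewrite !mult_INR; simpl; ring).
  replace (8 * (INR k * INR k)) with (INR (8 * (k * k))) by (rewrite !mult_INR; simpl; ring).
  destruct (Nat.le_gt_cases N (16 * k * L)) as [c|c1]; [left; now apply le_INR|right].
  destruct (Nat.le_gt_cases S (16 * (k * k) * L)) as [c|c2]; [left; now apply le_INR|right].
  apply le_INR; destruct (Nat.le_gt_cases G (8 * (k * k))) as [c|c3]; trivial.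
  (* With L + 1 the power doubles, and L + 1 <= 2 L. *)
  exfalso; apply hmax; repeat split.
  + clear - c1 L1; nia.
  + clear - c2 L1; nia.
  + clear - c3; nia.
Qed.

End Target.

(** The factor L lost above is thus at most logarithmic; the 2 comes from ln 2 > 1 / 2. *)
Lemma pow2_ln (N L : nat) : (2 ^ L <= N)%nat -> INR L <= 2 * ln (INR N).
Proof.
intros h; apply le_INR in h; rewrite pow_INR in h; change (INR 2) with 2 in h.
assert (p : 0 < 2 ^ L) by (apply pow_lt; lra).
assert (hl : ln (2 ^ L) <= ln (INR N)).
{ destruct h as [h|h]; [left; now apply ln_increasing|right; now rewrite h]. }
rewrite ln_pow in hl by lra.
pose proof ln_lt_2; pose proof (pos_INR L); nra.
Qed.

Theorem theorem4 :
  exists c a : R, 0 < c /\ 0 <= a /\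
    forall N S G : nat, (2 <= N)%nat -> (1 <= S)%nat -> (1 <= G)%nat ->
      exists F : formula,
        fwf N F /\ (fdepth F <= 3)%nat /\ (fsize F <= S)%nat /\ (fgates F <= G)%nat /\
        Q_ge N (fun x => feval x F)
          (c * Rmin (INR N) (Rmin (sqrt (INR S)) (sqrt (INR N) * Rpower (INR G) (1/4)))
             / Rpower (ln (INR N)) a).
Proof.
(* Surjectivity needs 12 * 2 * 36 = 864 <= 1000. OR needs 8 * 36 = 288 <= 1000 * ln N, where ln N >=
   1 / 2. *)
exists (1 / 1000), 1; split; [lra|split; [lra|]]; intros N S G N2 S1 G1.
assert (ln0 : 1 / 2 <= ln (INR N)).
{ pose proof (pow2_ln N 1 ltac:(simpl; lia)) as h; simpl in h; lra. }
rewrite Rpower_1 by lra.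
pose proof (target_bounds N S G N2 S1 G1) as [m0 _].
set (m := Rmin _ _) in *.
assert (div : forall r, m <= 1000 * ln (INR N) * r -> 1 / 1000 * m / ln (INR N) <= r).
{ intros r h; apply Rmult_le_reg_r with (ln (INR N)); [lra|].
  replace (1 / 1000 * m / ln (INR N) * ln (INR N)) with (1 / 1000 * m) by (field; lra).
  lra. }
destruct (Nat.le_gt_cases 8 N) as [N8|N8];
  [destruct (Nat.le_gt_cases 8 S) as [S8|S8]; [destruct (Nat.le_gt_cases 8 G) as [G8|G8]|]|].
1: { destruct (surj_case N S G N2 S1 G1 N8 S8 G8) as [L [t [L1 [t1 [hN [hS [hG hm]]]]]]].
  destruct (@surj_hard N L t L1 t1 hN) as [F [wf dep sz gt low]].
  exists F; split; [trivial|split; [trivial|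
    split; [exact (Nat.le_trans _ _ _ sz hS)|split; [exact (Nat.le_trans _ _ _ gt hG)|]]]].
  intros T hT; apply div; apply low in hT; fold m in hm.
  assert (hL : INR L <= 2 * ln (INR N)).
  { apply pow2_ln, Nat.le_trans with (2 := hN); clear - L1 t1.
    replace (4 * 2 ^ L * L * t)%nat with (2 ^ L * (4 * (L * t)))%nat by ring.
    rewrite <- (Nat.mul_1_r (2 ^ L)) at 1; apply Nat.mul_le_mono_l; nia. }
  pose proof (pos_INR L); pose proof (pos_INR T).
  assert (0 <= INR (2 ^ L) * sqrt (INR t)) by (apply Rmult_le_pos; [apply pos_INR|apply sqrt_pos]).
  assert (12 * INR L * (INR (2 ^ L) * sqrt (INR t)) <= 12 * (2 * ln (INR N)) * (36 * INR T))
    by (apply Rmult_le_compat; lra).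
  assert (0 <= ln (INR N) * INR T) by (apply Rmult_le_pos; lra).
  lra. }
all: pose proof (or_case N S G N2 S1 G1 ltac:(lia)) as hm; fold m in hm;
  destruct (@or_hard N (Nat.min N S) ltac:(lia) ltac:(lia)) as [F [wf dep sz gt low]];
  exists F; split; [trivial|split; [trivial|split; [lia|split; [lia|]]]];
  intros T hT; apply div; apply low in hT; pose proof (pos_INR T); nra.
Qed.
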